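(* Let $T\ge1$, $\rho>0$, and let $\mathcal{S}\subset\mathbb{C}^T\setminus\{\mathbf{0}\}$ be a finite nonempty set. For $\mathbf{s}\in\mathcal{S}$, $h\in\mathbb{C}$ and $\mathbf{y}\in\mathbb{C}^T$ let $p(\mathbf{y}\mid\mathbf{s},h)=\pi^{-T}\exp\big(-\|\mathbf{y}-\sqrt{\rho}\,h\,\mathbf{s}\|^2\big)$ be the density of $\mathbf{y}=\sqrt{\rho}\,h\,\mathbf{s}+\mathbf{w}$ with $\mathbf{w}\sim\mathcal{CN}(\mathbf{0},\mathbf{I}_T)$. Then for each $\mathbf{s}\in\mathcal{S}$ the maximum likelihood estimate of $h$, i.e. the maximizer of $h\mapsto p(\mathbf{y}\mid\mathbf{s},h)$ over $\mathbb{C}$, is $$\hat h(\mathbf{s})=\frac{\mathbf{s}^\dagger\mathbf{y}}{\sqrt{\rho}\,\|\mathbf{s}\|^2},$$ and the generalized likelihood ratio test decision satisfies $$\operatorname*{argmax}_{\mathbf{s}\in\mathcal{S}}\ p\big(\mathbf{y}\mid\mathbf{s},\hat h(\mathbf{s})\big)=\operatorname*{argmax}_{\mathbf{s}\in\mathcal{S}}\ \frac{|\mathbf{y}^\dagger\mathbf{s}|^2}{\|\mathbf{s}\|^2}.$$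
   Context: $\dagger$ denotes conjugate transpose. $\mathcal{CN}(\mathbf{0},\mathbf{I}_T)$ is the circularly symmetric complex Gaussian distribution with density $\pi^{-T}e^{-\|\mathbf{x}\|^2}$ on $\mathbb{C}^T$. $\operatorname{argmax}$ denotes the set of all maximizers. *)

(* Defs.v *)
From mathcomp Require Import all_boot all_order all_algebra spectral.
From mathcomp Require Import all_classical all_reals all_analysis.
From mathcomp Require Import complex.

Set Implicit Arguments.
Unset Strict Implicit.
Unset Printing Implicit Defensive.

Import Order.TTheory GRing.Theory Num.Theory.
Import Normc.

Local Open Scope classical_set_scope.
Local Open Scope ring_scope.
Local Open Scope complex_scope.
Local Open Scope sesquilinear_scope.

Definition argmax (R : realType) (X : Type) (A : set X) (f : X -> R) : set X :=
  [set x | A x /\ forall z, A z -> f z <= f x].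

(* Euclidean norm on C^T with values in R. The norm `|x| that the libraries put
   on matrices is the sup norm, and `|z| for z : R[i] has values in R[i]; [normc]
   is the real-valued modulus. *)
Definition l2norm (R : realType) (T : nat) (x : 'cV[R[i]]_T) : R :=
  Num.sqrt (\sum_(i < T) normc (x i 0) ^+ 2).

(* a^dagger b, the only entry of the 1 x 1 product matrix. *)
Definition cdot (R : realType) (T : nat) (a b : 'cV[R[i]]_T) : R[i] :=
  (a^t* *m b) 0 0.

(* Density of CN(0, I_T) with respect to Lebesgue measure on C^T = R^(2T). *)
Definition cn_pdf (R : realType) (T : nat) (x : 'cV[R[i]]_T) : R :=
  pi ^- T * expR (- (l2norm x ^+ 2)).

(* p(y | s, h): the law of y = sqrt(rho) h s + w with w ~ CN(0, I_T) is the
   translate of CN(0, I_T) by sqrt(rho) h s. *)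
Definition likelihood (R : realType) (T : nat) (rho : R)
    (y s : 'cV[R[i]]_T) (h : R[i]) : R :=
  cn_pdf (y - ((Num.sqrt rho)%:C * h) *: s).

Definition hhat (R : realType) (T : nat) (rho : R)
    (y s : 'cV[R[i]]_T) : R[i] :=
  cdot s y / (Num.sqrt rho * l2norm s ^+ 2)%:C.

(* Main.v *)
(* Completing the square: with n = ||s||^2 and b = s^dagger y,
     ||y - c s||^2 = ||y||^2 - |b|^2 / n + n |c - b / n|^2.
   For fixed s, only the last term depends on h, and it vanishes exactly at
   c = sqrt(rho) h = b / n.  At that h the likelihood is an increasing function
   of |b|^2 / n, because ||y||^2 does not depend on s. *)

Require Import Defs.
From mathcomp Require Import all_boot all_order all_algebra spectral.
From mathcomp Require Import all_classical all_reals all_analysis.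
From mathcomp Require Import complex.
From mathcomp Require Import ring.

Import Order.TTheory GRing.Theory Num.Theory.
Import Normc.

Local Open Scope classical_set_scope.
Local Open Scope ring_scope.
Local Open Scope complex_scope.

Lemma cdotE (R : realType) (T : nat) (a b : 'cV[R[i]]_T) :
  cdot a b = \sum_(i < T) (a i 0)^*%C * b i 0.
Proof. by rewrite /cdot mxE; apply: eq_bigr => i _; rewrite !mxE. Qed.

Lemma conj_cdot (R : realType) (T : nat) (a b : 'cV[R[i]]_T) :
  (cdot a b)^*%C = cdot b a.
Proof.
rewrite !cdotE rmorph_sum; apply: eq_bigr => i _.
by rewrite rmorphM /= conjcK mulrC.
Qed.

(** Bridge from real squared moduli to [R[i]], where they become products with a conjugate, open to
    ring identities. *)
Lemma normc_sqr (R : realType) (z : R[i]) : (normc z ^+ 2)%:C = z * z^*%C.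
Proof. by rewrite rmorphXn /= -[(normc z)%:C]/`|z| sqr_normc. Qed.

Lemma l2norm_sqr (R : realType) (T : nat) (x : 'cV[R[i]]_T) :
  l2norm x ^+ 2 = \sum_(i < T) normc (x i 0) ^+ 2.
Proof. by rewrite sqr_sqrtr // sumr_ge0 // => i _; rewrite sqr_ge0. Qed.

Lemma l2norm_sqr_cdot (R : realType) (T : nat) (x : 'cV[R[i]]_T) :
  (l2norm x ^+ 2)%:C = cdot x x.
Proof.
rewrite l2norm_sqr cdotE rmorph_sum; apply: eq_bigr => i _.
by rewrite /= normc_sqr mulrC.
Qed.

Lemma l2norm_sqr_gt0 (R : realType) (T : nat) (x : 'cV[R[i]]_T) :
  x <> 0 -> 0 < l2norm x ^+ 2.
Proof.
move=> x0; rewrite lt_def sqr_ge0 andbT l2norm_sqr; apply/eqP => sum0; apply: x0.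
apply/matrixP => i j; rewrite ord1 mxE; apply: eq0_normc.
have/psumr_eq0P := sum0 => /(_ (fun i _ => sqr_ge0 _)) /(_ i isT) /eqP.
by rewrite sqrf_eq0 => /eqP.
Qed.

Lemma cdot_residual (R : realType) (T : nat) (y s : 'cV[R[i]]_T) (c : R[i]) :
  cdot (y - c *: s) (y - c *: s) =
  cdot y y - c * cdot y s - c^*%C * cdot s y + c * c^*%C * cdot s s.
Proof.
rewrite !cdotE !mulr_sumr -!sumrN -!big_split; apply: eq_bigr => i _ /=.
by rewrite !mxE rmorphB rmorphM /=; ring.
Qed.

Lemma l2norm_residual (R : realType) (T : nat) (y s : 'cV[R[i]]_T) (c : R[i]) :
  s <> 0 ->
  l2norm (y - c *: s) ^+ 2 =
  l2norm y ^+ 2 - normc (cdot y s) ^+ 2 / l2norm s ^+ 2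
  + l2norm s ^+ 2 * normc (c - cdot s y / (l2norm s ^+ 2)%:C) ^+ 2.
Proof.
(* Since [R] embeds injectively in [R[i]], the identity can be checked there, as a rational identity
   in [c], its conjugate and the inner products of [y] and [s]. *)
move=> /l2norm_sqr_gt0 s_gt0; apply: (@complexI R).
have s0 : cdot s s != 0.
  by rewrite -l2norm_sqr_cdot; apply/eqP => -[] /eqP; rewrite gt_eqF.
have realCE (p q n t : R) :
    (p - q / n + n * t)%:C = p%:C - q%:C / n%:C + n%:C * t%:C.
  by rewrite rmorphD rmorphB !rmorphM fmorphV.
rewrite realCE !normc_sqr !l2norm_sqr_cdot cdot_residual.
have conjE (p q n : R[i]) : (p - q / n)^*%C = p^*%C - q^*%C / n^*%C.
  by rewrite rmorphB rmorphM fmorphV.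
(* Conjugation exchanges [cdot s y] and [cdot y s] and fixes [cdot s s], which is the only
   denominator left. *)
rewrite conjE !conj_cdot.
by field.
Qed.

(** Form from which both claims are read off: [h] enters only through its distance to
    [hhat rho y s]. The factor [rho] is the squared modulus of the [Num.sqrt rho] pulled out of the
    residual. *)
Lemma likelihoodE (R : realType) (T : nat) (rho : R)
    (y s : 'cV[R[i]]_T) (h : R[i]) :
  0 < rho -> s <> 0 ->
  likelihood rho y s h =
  pi ^- T * expR (normc (cdot y s) ^+ 2 / l2norm s ^+ 2 - l2norm y ^+ 2
    - l2norm s ^+ 2 * rho * normc (h - hhat rho y s) ^+ 2).
Proof.
move=> rho_gt0 s0.
rewrite /likelihood /cn_pdf l2norm_residual //; congr (_ * expR _).
have r0 : (Num.sqrt rho)%:C != 0 :> R[i].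
  by apply/eqP => -[] /eqP; rewrite sqrtr_eq0 leNgt rho_gt0.
have -> : (Num.sqrt rho)%:C * h - cdot s y / (l2norm s ^+ 2)%:C =
          (Num.sqrt rho)%:C * (h - hhat rho y s).
  by rewrite /hhat [in RHS]rmorphM /= mulrBr invfM [in RHS]mulrCA mulVKf.
have -> : normc ((Num.sqrt rho)%:C * (h - hhat rho y s)) ^+ 2 =
          rho * normc (h - hhat rho y s) ^+ 2.
  rewrite normcM exprMn; congr (_ * _).
  (* Two square roots cancel: the one in [normc] and the one in [Num.sqrt rho]. *)
  by rewrite /= expr0n addr0 sqr_sqrtr ?sqr_ge0 // sqr_sqrtr // ltW.
by rewrite mulrA opprD opprB.
Qed.

(** Maximizers depend only on the order that a function induces on [A]. *)
Lemma argmax_monotone (R : realType) (X : Type) (A : set X) (f g : X -> R) :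
  (forall x z, A x -> A z -> (f z <= f x) = (g z <= g x)) ->
  argmax A f = argmax A g.
Proof.
move=> fg; apply/seteqP; split=> x [Ax max_x]; split=> // z Az.
  by rewrite -fg // max_x.
by rewrite fg // max_x.
Qed.

Theorem mainTheorem3 (R : realType) (T : nat) (rho : R)
    (S : set 'cV[R[i]]_T) (y : 'cV[R[i]]_T)
    (T_ge1 : (1 <= T)%N) (rho_gt0 : 0 < rho)
    (S_finite : finite_set S) (S_nonempty : S !=set0)
    (S_nonzero : S `<=` ~` [set 0]) :
  (forall s : 'cV[R[i]]_T, S s ->
     argmax setT (fun h : R[i] => likelihood rho y s h) = [set hhat rho y s])
  /\
  argmax S (fun s => likelihood rho y s (hhat rho y s)) =
  argmax S (fun s => normc (cdot y s) ^+ 2 / l2norm s ^+ 2).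
Proof.
have pi_gt0 : 0 < pi ^- T :> R by rewrite invr_gt0 exprn_gt0 // pi_gt0.
split=> [s Ss|].
  have s0 : s <> 0 by exact: S_nonzero.
  have k_gt0 : 0 < l2norm s ^+ 2 * rho by rewrite mulr_gt0 // l2norm_sqr_gt0.
  have lik_le h h' : (likelihood rho y s h' <= likelihood rho y s h) =
      (normc (h - hhat rho y s) ^+ 2 <= normc (h' - hhat rho y s) ^+ 2).
    by rewrite !likelihoodE // ler_pM2l // ler_expR lerD2l lerN2 ler_pM2l.
  (* Testing a maximizer [h] against [hhat rho y s] itself bounds its squared distance to that point
     by 0, which gives uniqueness. *)
  apply/seteqP; split=> [h [_ /(_ (hhat rho y s) I)]|_ ->].
    rewrite lik_le subrr normc0 expr0n /= => le0.
    apply/eqP; rewrite -subr_eq0; apply/eqP/eq0_normc/eqP.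
    by rewrite -sqrf_eq0 eq_le le0 sqr_ge0.
  by split=> [|h _]; [exact: I | rewrite lik_le subrr normc0 expr0n; exact: sqr_ge0].
apply: argmax_monotone => s t /S_nonzero s0 /S_nonzero t0.
(* At the estimates the distance terms vanish; the remaining [l2norm y ^+ 2] is common to [s] and
   [t] and cancels. *)
rewrite !likelihoodE // !subrr normc0 expr0n !mulr0 !subr0.
by rewrite ler_pM2l // ler_expR lerD2r.
Qed.
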